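(* Let $l$ be a line in $\mathcal{P}$ and let $\mathcal{P}_{l_A}$ be the set of arrows with tail and head on $l$. Then the relation $\Re_l$ is an equivalence relation on $\mathcal{P}_{l_A}$.
   Context: Let $\mathcal{P}$ be a set whose elements are called points. An arrow is an ordered pair of points $\overrightarrow{AB}=(A,B)$ (tail $A$, head $B$; $A=B$ is allowed). The arrow space $\mathcal{P}_A$ is the set of all arrows; two arrows are equal iff they have the same tail and the same head. Negation: $-\overrightarrow{AB}=\overrightarrow{BA}$. Arrow addition is the partial operation $\overrightarrow{AB}+_A\overrightarrow{BC}=\overrightarrow{AC}$, defined exactly when the head of the first arrow equals the tail of the second. Axiom 1: there is a given map (arrow pre-inner product) $\langle -,-\rangle_A:\mathcal{P}_A\times\mathcal{P}_A\to\mathbb{R}$ such that for all points: $\langle\overrightarrow{AB},\overrightarrow{AB}\rangle_A\ge 0$, with equality iff $A=B$; $\langle\overrightarrow{AB},\overrightarrow{CD}\rangle_A=\langle\overrightarrow{CD},\overrightarrow{AB}\rangle_A$; $\langle\overrightarrow{AB}+_A\overrightarrow{BC},\overrightarrow{LM}\rangle_A=\langle\overrightarrow{AB},\overrightarrow{LM}\rangle_A+\langle\overrightarrow{BC},\overrightarrow{LM}\rangle_A$; $\langle-\overrightarrow{AB},\overrightarrow{CD}\rangle_A=-\langle\overrightarrow{AB},\overrightarrow{CD}\rangle_A$. Measure: $\|\overrightarrow{AB}\|_A=\sqrt{\langle\overrightarrow{AB},\overrightarrow{AB}\rangle_A}$. Scalar multiplication: for $t\in\mathbb{R}$, if $A=B$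 or $t=0$ then $(t)\overrightarrow{AB}=\overrightarrow{AA}$. If $A\ne B$ and $t\neq0$ then $(t)\overrightarrow{AB}=\overrightarrow{AD}$, where $D\in\mathcal{P}$ is a point (assumed to exist) with $\|\overrightarrow{AD}\|_A=|t|\,\|\overrightarrow{AB}\|_A$ and $\langle\overrightarrow{AB},\overrightarrow{AD}\rangle_A=\|\overrightarrow{AB}\|_A\|\overrightarrow{AD}\|_A$ if $t>0$, $=-\|\overrightarrow{AB}\|_A\|\overrightarrow{AD}\|_A$ if $t<0$. Axiom 2: $\langle(t)\overrightarrow{AB},\overrightarrow{CD}\rangle_A=t\langle\overrightarrow{AB},\overrightarrow{CD}\rangle_A$ for all arrows and all $t\in\mathbb{R}$. Line: for distinct points $O,P$, $l_{OP}=\{C\in\mathcal{P}:\ \exists t\in\mathbb{R},\ \overrightarrow{OC}=(t)\overrightarrow{OP}\}$; a line is a set of this form. Axiom 3: for every line there is a one-to-one correspondence between $\mathbb{R}$ and the set of points on the line. Relation $\Re_l$ on $\mathcal{P}_{l_A}$: $\overrightarrow{AB}\;\Re_l\;\overrightarrow{CD}$ iff either $A=B$ and $C=D$, or ($A\ne B$, $C\neq D$ and) $\|\overrightarrow{AB}\|_A=\|\overrightarrow{CD}\|_A$ and $\frac{\langle\overrightarrow{AB},\overrightarrow{CD}\rangle_A}{\|\overrightarrow{AB}\|_A\|\overrightarrow{CD}\|_A}=1$. *)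

(* Defs.v *)
From mathcomp Require Import all_boot all_order all_algebra.
From mathcomp Require Import boolp classical_sets functions cardinality reals.
From Stdlib Require Import Relation_Definitions RelationClasses.

Set Implicit Arguments.
Unset Strict Implicit.
Unset Printing Implicit Defensive.

Import Order.TTheory GRing.Theory Num.Theory.
Local Open Scope ring_scope.
Local Open Scope classical_set_scope.
Local Open Scope card_scope.

Definition arrow (P : Type) : Type := (P * P)%type.

Definition arrow_tail (P : Type) (a : arrow P) : P := a.1.
Definition arrow_head (P : Type) (a : arrow P) : P := a.2.

Definition arrow_opp (P : Type) (a : arrow P) : arrow P :=
  (arrow_head a, arrow_tail a).

(* Addition is partial: its domain is enforced by the proof argument. *)
Definition arrow_add (P : Type) (a b : arrow P)
    (_ : arrow_head a = arrow_tail b) : arrow P :=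
  (arrow_tail a, arrow_head b).

Record pre_inner_product (R : realType) (P : Type) := PreInnerProduct {
  ip :> arrow P -> arrow P -> R;
  ip_ge0 : forall a, 0 <= ip a a;
  ip_eq0 : forall a, ip a a = 0 <-> arrow_tail a = arrow_head a;
  ip_sym : forall a b, ip a b = ip b a;
  ip_add : forall a b c (ab : arrow_head a = arrow_tail b),
    ip (arrow_add ab) c = ip a c + ip b c;
  ip_opp : forall a b, ip (arrow_opp a) b = - ip a b }.

Definition arrow_measure (R : realType) (P : Type) (g : pre_inner_product R P)
  (a : arrow P) : R := Num.sqrt (g a a).

(* [is_scaled g t a b] says that b is a value allowed for (t)a. *)
Definition is_scaled (R : realType) (P : Type) (g : pre_inner_product R P)
    (t : R) (a b : arrow P) : Prop :=
  (arrow_tail a = arrow_head a \/ t = 0 -> b = (arrow_tail a, arrow_tail a)) /\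
  (arrow_tail a <> arrow_head a -> t <> 0 ->
    [/\ arrow_tail b = arrow_tail a,
        arrow_measure g b = `|t| * arrow_measure g a,
        0 < t -> g a b = arrow_measure g a * arrow_measure g b &
        t < 0 -> g a b = - (arrow_measure g a * arrow_measure g b)]).

(* The existence of the head of (t)a is part of the data [smul]; it is unique
   because of [ip_smul]. *)
Record scalar_multiplication (R : realType) (P : Type)
    (g : pre_inner_product R P) := ScalarMultiplication {
  smul :> R -> arrow P -> arrow P;
  smul_scaled : forall t a, is_scaled g t a (smul t a);
  ip_smul : forall t a b, g (smul t a) b = t * g a b }.

Definition line_through (R : realType) (P : Type) (g : pre_inner_product R P)
    (s : scalar_multiplication g) (O Q : P) : set P :=
  [set C | exists t : R, (O, C) = s t (O, Q)].

Definition is_line (R : realType) (P : Type) (g : pre_inner_product R P)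
    (s : scalar_multiplication g) (l : set P) : Prop :=
  exists O Q : P, O <> Q /\ l = line_through s O Q.

Definition lines_equipotent_to_reals (R : realType) (P : Type)
    (g : pre_inner_product R P) (s : scalar_multiplication g) : Prop :=
  forall l : set P, is_line s l -> [set: R] #= l.

Definition line_arrows (P : Type) (l : set P) : set (arrow P) :=
  [set a | l (arrow_tail a) /\ l (arrow_head a)].

Definition line_rel (R : realType) (P : Type) (g : pre_inner_product R P)
    (l : set P) : relation (set_type (line_arrows l)) :=
  fun x y => let a := \val x in let b := \val y in
  (arrow_tail a = arrow_head a /\ arrow_tail b = arrow_head b) \/
  [/\ arrow_tail a <> arrow_head a, arrow_tail b <> arrow_head b,
      arrow_measure g a = arrow_measure g b &
      g a b / (arrow_measure g a * arrow_measure g b) = 1].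

(* Main.v *)
(** Every arrow a on the line through O and Q satisfies <a, c> = t <OQ, c> for
    some real t and all arrows c. Two arrows on the line are then related
    exactly when they have the same inner product with every arrow, and this
    is visibly an equivalence relation. *)
Require Import Defs.
From mathcomp Require Import all_boot all_order all_algebra.
From mathcomp Require Import boolp classical_sets functions cardinality reals.
From Stdlib Require Import Relation_Definitions RelationClasses.

Import Order.TTheory GRing.Theory Num.Theory.
Local Open Scope ring_scope.

Lemma arrow_measure_sqr (R : realType) (P : Type) (g : pre_inner_product R P)
    (a : arrow P) :
  arrow_measure g a * arrow_measure g a = g a a.
Proof. by rewrite -expr2 sqr_sqrtr // ip_ge0. Qed.

(** A degenerate arrow is its own opposite, so its product with [c] equals its own negative. *)
Lemma ip_degenerate (R : realType) (P : Type) (g : pre_inner_product R P)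
    (a c : arrow P) :
  arrow_tail a = arrow_head a -> g a c = 0.
Proof.
case: a => A _ /= <-.
by apply/eqP; rewrite -eqNr -(ip_opp g (A, A)).
Qed.

(** Split AB as AO + OB, where AO is the opposite of OA. If OA and OB are the multiples [t] and [u]
    of OQ, the coefficient of AB is [u - t]. *)
Lemma line_arrow_coord (R : realType) (P : Type) (g : pre_inner_product R P)
    (s : scalar_multiplication g) (O Q : P) (a : arrow P) :
  line_arrows (line_through s O Q) a ->
  exists t : R, forall c, g a c = t * g (O, Q) c.
Proof.
case: a => A B [[t /= OA] [u /= OB]]; exists (u - t) => c.
have := @ip_add _ _ g (A, O) (O, B) c erefl.
rewrite /arrow_add /= => ->.
have := ip_opp g (O, A) c; rewrite /arrow_opp /= => ->.
by rewrite OA OB !ip_smul mulrBl addrC.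
Qed.

Arguments line_arrow_coord {R P g s O Q a}.

Lemma line_relP (R : realType) (P : Type) (g : pre_inner_product R P)
    (s : scalar_multiplication g) (l : set P) (hl : is_line s l)
    (x y : set_type (line_arrows l)) :
  line_rel g x y <-> forall c, g (\val x) c = g (\val y) c.
Proof.
have : line_arrows l (\val x) by exact: set_valP.
have : line_arrows l (\val y) by exact: set_valP.
rewrite /line_rel; move: (\val x) (\val y) => /= a b.
case: hl => O [Q [_ ->]] b_l a_l.
have [t aE] := line_arrow_coord a_l.
have [u bE] := line_arrow_coord b_l.
split=> [[[a0 b0] c|[a0 _ mab ratio] c]|ab].
- by rewrite !ip_degenerate.
- have aa0 : g a a != 0 by apply/eqP => /(ip_eq0 g).
  (* Since the measures agree, the denominator of the ratio is [g a a]. *)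
  have ab : g a b = g a a.
    by move: ratio; rewrite -mab arrow_measure_sqr => /divr1_eq.
  have OQa0 : g (O, Q) a != 0.
    by move: aa0; rewrite aE mulf_eq0 negb_or => /andP[].
  (* In coordinates [ab] reads u <OQ,a> = t <OQ,a>; cancelling the nonzero factor gives [u = t]. *)
  move: ab; rewrite ip_sym bE aE => /(mulIf OQa0) ut.
  by rewrite aE bE ut.
- have aabb : g a a = g b b by rewrite ab ip_sym ab.
  (* By definiteness, the common value of [g a a] and [g b b] decides whether both arrows are
     degenerate or neither is. *)
  have [aa0|aa0] := eqVneq (g a a) 0.
    by left; split; apply/(ip_eq0 g); rewrite -?aabb.
  have mab : arrow_measure g a = arrow_measure g b.
    by rewrite /arrow_measure aabb.
  right; split=> //.
  + by move/(ip_eq0 g)/eqP; apply/negP.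
  + by move/(ip_eq0 g)/eqP; rewrite -aabb; apply/negP.
  + by rewrite -mab arrow_measure_sqr ip_sym -ab divff.
Qed.

Arguments line_relP {R P g s l} hl {x y}.

Theorem theorem39 (R : realType) (P : Type) (g : pre_inner_product R P)
    (s : scalar_multiplication g) (ax3 : lines_equipotent_to_reals s)
    (l : set P) (hl : is_line s l) :
  Equivalence (@line_rel R P g l).
Proof.
split=> [x|x y|x y z].
- exact/(line_relP hl).
- by move=> /(line_relP hl) xy; apply/(line_relP hl) => c; rewrite xy.
- move=> /(line_relP hl) xy /(line_relP hl) yz.
  by apply/(line_relP hl) => c; rewrite xy yz.
Qed.
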